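(* Let $\mathbb{F}$ be a field, let $R$ be an associative unital $\mathbb{F}$-algebra and let $G$ be a group. Let $\Gamma=\Gamma_{G,R}$, the group $K=(R^* )^G\rtimes(\mathrm{Aut}_{\mathbb{F}}(R)\times\mathrm{Aut}(G))$, and the maps $\lambda,\varphi,\phi$ on pairs $(\alpha,\eta)$ (for $\lambda\in (R^* )^G$, $\varphi\in\mathrm{Aut}_{\mathbb{F}}(R)$, $\phi\in\mathrm{Aut}(G)$) be as defined in the context. Then $$(\lambda\varphi\phi)\cdot(\alpha,\eta):=\lambda(\varphi(\phi(\alpha,\eta)))$$ defines a group action of $K$ on $\Gamma$ (in particular it maps $\Gamma$ into $\Gamma$), and for all $(\alpha,\eta),(\alpha',\eta')\in\Gamma$ the two crossed products $R^{\alpha}_{\eta}G$ and $R^{\alpha'}_{\eta'}G$ \begin{enumerate} \item are equivalent as Clifford systems if and only if $(\alpha,\eta)$ and $(\alpha',\eta')$ are in the same $(R^* )^G$-orbit; \item are graded isomorphic if and only if $(\alpha,\eta)$ and $(\alpha',\eta')$ are in the same $(R^* )^G\rtimes\mathrm{Aut}_{\mathbb{F}}(R)$-orbit; \item are graded isometric if and only if $(\alpha,\eta)$ and $(\alpha',\eta')$ are in the same $(R^* )^G\rtimes\mathrm{Aut}(G)$-orbit; \item are graded equivalent if and only if $(\alpha,\eta)$ and $(\alpha',\eta')$ are in the same $K$-orbit. \end{enumerate}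
   Context: Notation. $R^*$ is the group of units of $R$; $\mathrm{Aut}_{\mathbb{F}}(R)$ is the group of $\mathbb{F}$-algebra automorphisms of $R$; for $r\in R^*$, $\iota_r$ is the inner automorphism $\iota_r(s)=rsr^{-1}$, and $\mathrm{Inn}(R)=\{\iota_r : r\in R^*\}$. Outer actions and $\Gamma$. An outer action of $G$ on $R$ is a map $\eta:G\to\mathrm{Aut}_{\mathbb{F}}(R)$ with $\eta(g)\eta(h)\eta(gh)^{-1}\in\mathrm{Inn}(R)$ for all $g,h\in G$; $\mathrm{Out}(G,R)$ is the set of all outer actions. $(R^* )^{G\times G}$ is the set of functions $G\times G\to R^*$. The set $\Gamma=\Gamma_{G,R}\subseteq (R^* )^{G\times G}\times\mathrm{Out}(G,R)$ consists of all pairs $(\alpha,\eta)$ such that for all $g_1,g_2,g_3,g,h\in G$ $$\alpha(g_1,g_2)\,\alpha(g_1g_2,g_3)=\eta(g_1)(\alpha(g_2,g_3))\,\alpha(g_1,g_2g_3),\qquad \eta(g)\circ\eta(h)=\iota_{\alpha(g,h)}\circ\eta(gh).$$ Crossed products. For $(\alpha,\eta)\in\Gamma$, the crossed product $R^{\alpha}_{\eta}G$ is the $\mathbb{F}$-algebra that is a free left $R$-module with basis $\{u_g\}_{g\in G}$ and multiplication $(r u_g)(s u_h)=r\,\eta(g)(s)\,\alpha(g,h)\,u_{gh}$ for $r,s\in R$, $g,h\in G$; it is $G$-graded with homogeneous components $Ru_g$. The algebra $R$ is embedded in $R^{\alpha}_{\eta}G$ via $r\mapsto r\cdot 1$, and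 its image is the identity component. Equivalence relations. Let $A=R^{\alpha}_{\eta}G$ and $B=R^{\alpha'}_{\eta'}G$, with homogeneous components $A_g,B_g$. - $A$ and $B$ are graded isomorphic if there is an $\mathbb{F}$-algebra isomorphism $\psi:A\to B$ with $\psi(A_g)=B_g$ for all $g\in G$. - $A$ and $B$ are graded equivalent if there are an $\mathbb{F}$-algebra isomorphism $\psi:A\to B$ (called a graded equivalence) and a group automorphism $\phi$ of $G$ with $\psi(A_g)=B_{\phi(g)}$ for all $g\in G$. - $A$ and $B$ are equivalent as Clifford systems if there is a graded isomorphism $\psi:A\to B$ with $\psi(r)=r$ for all $r\in R$ (with $R$ viewed inside $A$ and $B$ via the embeddings above). - $A$ and $B$ are graded isometric ($R$-isometric) if there is a graded equivalence $\psi:A\to B$ with $\psi(r)=r$ for all $r\in R$. The group $K$. $(R^* )^G$ is the group of functions $\lambda:G\to R^*$ under pointwise multiplication. For $\varphi\in\mathrm{Aut}_{\mathbb{F}}(R)$ and $\phi\in\mathrm{Aut}(G)$ put $\varphi(\lambda)(g)=\varphi(\lambda(g))$ and $\phi(\lambda)(g)=\lambda(\phi^{-1}(g))$. These give commuting actions by group automorphisms, and $K=(R^* )^G\rtimes(\mathrm{Aut}_{\mathbb{F}}(R)\times\mathrm{Aut}(G))$ is the corresponding semidirect product, with relations $\varphi\cdot\lambda=\varphi(\lambda)\cdot\varphi$, $\phi\cdot\lambda=\phi(\lambda)\cdot\phi$, $\varphi\cdot\phi=\phi\cdot\varphi$. Every element of $K$ is written uniquely as $\lambda\varphi\phi$.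 The groups $(R^* )^G$, $(R^* )^G\rtimes\mathrm{Aut}_{\mathbb{F}}(R)$ and $(R^* )^G\rtimes\mathrm{Aut}(G)$ are regarded as subgroups of $K$. The maps. For $(\alpha,\eta)\in(R^* )^{G\times G}\times\mathrm{Out}(G,R)$ and $g,g_1,g_2\in G$, $r\in R$: - $\varphi(\alpha,\eta)=(\varphi(\alpha),\varphi(\eta))$ with $\varphi(\alpha)(g_1,g_2)=\varphi(\alpha(g_1,g_2))$ and $\varphi(\eta)(g)=\varphi\circ\eta(g)\circ\varphi^{-1}$; - $\phi(\alpha,\eta)=(\phi(\alpha),\phi(\eta))$ with $\phi(\alpha)(g_1,g_2)=\alpha(\phi^{-1}(g_1),\phi^{-1}(g_2))$ and $\phi(\eta)(g)=\eta(\phi^{-1}(g))$; - $\lambda(\alpha,\eta)=(\lambda_\eta(\alpha),\lambda(\eta))$ with $\lambda(\eta)(g)(r)=\lambda(g)\,\eta(g)(r)\,\lambda(g)^{-1}$ and $\lambda_\eta(\alpha)(g_1,g_2)=\lambda(g_1)\,\eta(g_1)(\lambda(g_2))\,\alpha(g_1,g_2)\,\lambda(g_1g_2)^{-1}$. *)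

(* Defs.v *)
From HB Require Import structures.
From mathcomp Require Import all_boot all_algebra.
From mathcomp Require Import boolp classical_sets.
From mathcomp Require Import finmap monalg.

Set Implicit Arguments.
Unset Strict Implicit.
Unset Printing Implicit Defensive.

Import GRing.Theory.

Local Open Scope ring_scope.

(* Associative unital F-algebras, the zero algebra included: the library's
   [algType F] requires 1 != 0.  The scalar multiplication is a fresh operation
   because Hierarchy-Builder does not allow [GRing.Lmodule] to be joined with
   possibly trivial rings outside of ssralg. *)
HB.mixin Record hasAlgScale (F : pzRingType) A of GRing.PzRing A := {
  ascale : F -> A -> A;
  ascaleA : forall (a b : F) (x : A), ascale a (ascale b x) = ascale (a * b) x;
  ascale1 : forall x : A, ascale 1 x = x;
  ascaleDr : forall (a : F) (x y : A),
    ascale a (x + y) = ascale a x + ascale a y;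
  ascaleDl : forall (a b : F) (x : A),
    ascale (a + b) x = ascale a x + ascale b x;
  ascaleAl : forall (a : F) (x y : A), ascale a (x * y) = ascale a x * y;
  ascaleAr : forall (a : F) (x y : A), ascale a (x * y) = x * ascale a y
}.

#[short(type="pzAlgType")]
HB.structure Definition PzAlgebra (F : pzRingType) :=
  {A of GRing.PzRing A & hasAlgScale F A}.

HB.instance Definition _ (F : pzRingType) (A : algType F) :=
  hasAlgScale.Build F A (@scalerA F A) (@scale1r F A) (@scalerDr F A)
    (fun a b x => @scalerDl F A x a b) (@scalerAl F A) (@scalerAr F A).

Lemma ascale0 (F : pzRingType) (A : pzAlgType F) (a : F) :
  ascale a (0 : A) = 0.
Proof. by apply: (addIr (ascale a 0)); rewrite -ascaleDr !add0r. Qed.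

Definition is_alg_morph (F : pzRingType) (A B : pzAlgType F) (f : A -> B) :=
  [/\ {morph f : x y / x + y}, forall a : F, {morph f : x / ascale a x},
      f 1 = 1 & {morph f : x y / x * y}].

Definition is_alg_iso (F : pzRingType) (A B : pzAlgType F) (f : A -> B) :=
  is_alg_morph f /\ bijective f.

(* R^*, for an arbitrary ring: [uvalV] is the (necessarily unique) inverse. *)
Section Units.
Variable R : pzRingType.

Record units := Units {
  uval :> R;
  uvalV : R;
  uvalVK : uvalV * uval = 1;
  uvalKV : uval * uvalV = 1
}.

HB.instance Definition _ := gen_eqMixin units.
HB.instance Definition _ := gen_choiceMixin units.

Lemma units_inj : injective uval.
Proof.
move=> [x x' x'x xx'] [y y' y'y yy'] /= exy; move: y'y yy'; rewrite -exy.
move=> y'x xy'; have ey : x' = y' by rewrite -[x']mulr1 -xy' mulrA x'x mul1r.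
by move: x'x xx'; rewrite ey => ? ?; congr Units; apply: Prop_irrelevance.
Qed.

Definition units_one := @Units 1 1 (mulr1 1) (mulr1 1).
Definition units_inv (u : units) := Units (uvalKV u) (uvalVK u).

Fact units_mulVK (u v : units) : (uvalV v * uvalV u) * (uval u * uval v) = 1.
Proof. by rewrite mulrA -(mulrA (uvalV v)) uvalVK mulr1 uvalVK. Qed.
Fact units_mulKV (u v : units) : (uval u * uval v) * (uvalV v * uvalV u) = 1.
Proof. by rewrite mulrA -(mulrA (uval u)) uvalKV mulr1 uvalKV. Qed.
Definition units_mul (u v : units) := Units (units_mulVK u v) (units_mulKV u v).

Fact units_mulA : associative units_mul.
Proof. by move=> u v w; apply: units_inj; rewrite /= mulrA. Qed.
Fact units_mul1 : left_id units_one units_mul.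
Proof. by move=> u; apply: units_inj; rewrite /= mul1r. Qed.
Fact units_1mul : right_id units_one units_mul.
Proof. by move=> u; apply: units_inj; rewrite /= mulr1. Qed.
Fact units_mulV : left_inverse units_one units_inv units_mul.
Proof. by move=> u; apply: units_inj; rewrite /= uvalVK. Qed.
Fact units_Vmul : right_inverse units_one units_inv units_mul.
Proof. by move=> u; apply: units_inj; rewrite /= uvalKV. Qed.

HB.instance Definition _ := isGroup.Build units
  units_mulA units_mul1 units_1mul units_mulV units_Vmul.

Lemma uval1 : uval 1%g = 1. Proof. by []. Qed.
Lemma uvalM (u v : units) : uval (u * v)%g = uval u * uval v. Proof. by []. Qed.
Lemma mulVu (u : units) : uval u^-1%g * uval u = 1. Proof. exact: uvalVK. Qed.
Lemma muluV (u : units) : uval u * uval u^-1%g = 1. Proof. exact: uvalKV. Qed.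

End Units.

(* The group law on automorphism groups is composition: (f * g) x = f (g x). *)
Section AlgebraAut.
Variables (F : pzRingType) (R : pzAlgType F).

Record algAut := AlgAut {
  aut_fun :> R -> R;
  aut_inv : R -> R;
  aut_funK : cancel aut_fun aut_inv;
  aut_invK : cancel aut_inv aut_fun;
  aut_morph : is_alg_morph aut_fun
}.

HB.instance Definition _ := gen_eqMixin algAut.
HB.instance Definition _ := gen_choiceMixin algAut.

Fact aut_additive (f : algAut) : zmod_morphism f.
Proof.
case: (aut_morph f) => fD _ _ _ x y.
by apply: (addIr (f y)); rewrite -fD !subrK.
Qed.
Fact aut_monoid (f : algAut) : GRing.monoid_morphism f.
Proof. by case: (aut_morph f). Qed.
HB.instance Definition _ (f : algAut) :=
  GRing.isZmodMorphism.Build R R (aut_fun f) (aut_additive f).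
HB.instance Definition _ (f : algAut) :=
  GRing.isMonoidMorphism.Build R R (aut_fun f) (aut_monoid f).

Lemma aut_scale (f : algAut) a : {morph f : x / ascale a x}.
Proof. by case: (aut_morph f). Qed.

Lemma algAutP (f g : algAut) : f =1 g -> f = g.
Proof.
case: f g => [f f' fK f'K fm] [g g' gK g'K gm] /= /funext efg.
rewrite -{}efg in gK g'K gm *.
have e' : f' = g' by apply/funext => x; rewrite -{1}(g'K x) fK.
by rewrite -{}e' in gK g'K *; congr AlgAut; apply: Prop_irrelevance.
Qed.

Definition aut_one :=
  @AlgAut id id (fun=> erefl) (fun=> erefl) 
    (And4 (fun _ _ => erefl) (fun _ _ => erefl) erefl (fun _ _ => erefl)).

Fact aut_comp_morph (f g : algAut) : is_alg_morph (f \o g).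
Proof.
split=> [x y|a x||x y] /=.
- by rewrite !raddfD.
- by rewrite !aut_scale.
- by rewrite !rmorph1.
- by rewrite !rmorphM.
Qed.
Definition aut_mul (f g : algAut) := AlgAut
  (can_comp (aut_funK f) (aut_funK g)) (can_comp (aut_invK g) (aut_invK f))
  (aut_comp_morph f g).

Fact aut_inv_morph (f : algAut) : is_alg_morph (aut_inv f).
Proof.
split=> [x y|a x||x y]; apply: (can_inj (aut_funK f)).
- by rewrite raddfD /= !aut_invK.
- by rewrite aut_scale !aut_invK.
- by rewrite rmorph1 aut_invK.
- by rewrite rmorphM /= !aut_invK.
Qed.
Definition aut_invg (f : algAut) :=
  AlgAut (aut_invK f) (aut_funK f) (aut_inv_morph f).

Fact aut_mulA : associative aut_mul.
Proof. by move=> f g h; apply: algAutP. Qed.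
Fact aut_mul1 : left_id aut_one aut_mul.
Proof. by move=> f; apply: algAutP. Qed.
Fact aut_1mul : right_id aut_one aut_mul.
Proof. by move=> f; apply: algAutP. Qed.
Fact aut_mulV : left_inverse aut_one aut_invg aut_mul.
Proof. by move=> f; apply: algAutP => x /=; rewrite aut_funK. Qed.
Fact aut_Vmul : right_inverse aut_one aut_invg aut_mul.
Proof. by move=> f; apply: algAutP => x /=; rewrite aut_invK. Qed.

HB.instance Definition _ := isGroup.Build algAut
  aut_mulA aut_mul1 aut_1mul aut_mulV aut_Vmul.

Fact unit_map_VK (f : algAut) (u : units R) : f (uvalV u) * f (uval u) = 1.
Proof. by rewrite -rmorphM uvalVK rmorph1. Qed.
Fact unit_map_KV (f : algAut) (u : units R) : f (uval u) * f (uvalV u) = 1.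
Proof. by rewrite -rmorphM uvalKV rmorph1. Qed.
Definition unit_map (f : algAut) (u : units R) :=
  Units (unit_map_VK f u) (unit_map_KV f u).

Section Inner.
Variable r : units R.
Definition inner_fun (s : R) : R := uval r * s * uval r^-1%g.
Definition inner_inv (s : R) : R := uval r^-1%g * s * uval r.
Fact inner_funK : cancel inner_fun inner_inv.
Proof.
move=> s; rewrite /inner_fun /inner_inv !mulrA mulVu mul1r -mulrA.
by rewrite mulVu mulr1.
Qed.
Fact inner_invK : cancel inner_inv inner_fun.
Proof.
move=> s; rewrite /inner_fun /inner_inv !mulrA muluV mul1r -mulrA.
by rewrite muluV mulr1.
Qed.
Fact inner_morph : is_alg_morph inner_fun.
Proof.
split=> [x y|a x||x y]; rewrite /inner_fun.
- by rewrite mulrDr mulrDl.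
- by rewrite ascaleAl ascaleAr.
- by rewrite mulr1 muluV.
- by rewrite !mulrA; congr (_ * _ * _); rewrite -(mulrA (uval r * x)) mulVu mulr1.
Qed.
Definition inner := AlgAut inner_funK inner_invK inner_morph.
End Inner.

Definition Inn : set algAut := range inner.

End AlgebraAut.

Section GroupAut.
Variable G : groupType.

Record grpAut := GrpAut {
  gaut_fun :> G -> G;
  gaut_inv : G -> G;
  gaut_funK : cancel gaut_fun gaut_inv;
  gaut_invK : cancel gaut_inv gaut_fun;
  gaut_morph : {morph gaut_fun : x y / (x * y)%g}
}.

HB.instance Definition _ := gen_eqMixin grpAut.
HB.instance Definition _ := gen_choiceMixin grpAut.

Lemma grpAutP (f g : grpAut) : f =1 g -> f = g.
Proof.
case: f g => [f f' fK f'K fm] [g g' gK g'K gm] /= /funext efg.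
rewrite -{}efg in gK g'K gm *.
have e' : f' = g' by apply/funext => x; rewrite -{1}(g'K x) fK.
by rewrite -{}e' in gK g'K *; congr GrpAut; apply: Prop_irrelevance.
Qed.

Definition gaut_one :=
  @GrpAut id id (fun=> erefl) (fun=> erefl) (fun _ _ => erefl).

Fact gaut_comp_morph (f g : grpAut) : {morph f \o g : x y / (x * y)%g}.
Proof. by move=> x y; rewrite /= !gaut_morph. Qed.
Definition gaut_mul (f g : grpAut) := GrpAut
  (can_comp (gaut_funK f) (gaut_funK g)) (can_comp (gaut_invK g) (gaut_invK f))
  (gaut_comp_morph f g).

Fact gaut_inv_morph (f : grpAut) : {morph gaut_inv f : x y / (x * y)%g}.
Proof.
move=> x y; apply: (can_inj (gaut_funK f)).
by rewrite gaut_morph !gaut_invK.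
Qed.
Definition gaut_invg (f : grpAut) :=
  GrpAut (gaut_invK f) (gaut_funK f) (gaut_inv_morph f).

Fact gaut_mulA : associative gaut_mul.
Proof. by move=> f g h; apply: grpAutP. Qed.
Fact gaut_mul1 : left_id gaut_one gaut_mul.
Proof. by move=> f; apply: grpAutP. Qed.
Fact gaut_1mul : right_id gaut_one gaut_mul.
Proof. by move=> f; apply: grpAutP. Qed.
Fact gaut_mulV : left_inverse gaut_one gaut_invg gaut_mul.
Proof. by move=> f; apply: grpAutP => x /=; rewrite gaut_funK. Qed.
Fact gaut_Vmul : right_inverse gaut_one gaut_invg gaut_mul.
Proof. by move=> f; apply: grpAutP => x /=; rewrite gaut_invK. Qed.

HB.instance Definition _ := isGroup.Build grpAut
  gaut_mulA gaut_mul1 gaut_1mul gaut_mulV gaut_Vmul.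

End GroupAut.

Section Gamma.
Variables (F : pzRingType) (R : pzAlgType F) (G : groupType).
Implicit Types (alpha : G -> G -> units R) (eta : G -> algAut R).
Implicit Types (lam : G -> units R) (phi : algAut R) (sigma : grpAut G).

Definition Out : set (G -> algAut R) :=
  [set eta | forall g h, Inn (eta g * eta h * (eta (g * h))^-1)%g].

Definition cpair : Type := (G -> G -> units R) * (G -> algAut R).

Definition Gamma : set cpair :=
  [set p | let: (alpha, eta) := p in
    [/\ Out eta,
        forall g1 g2 g3 : G,
          uval (alpha g1 g2) * uval (alpha (g1 * g2)%g g3)
          = eta g1 (uval (alpha g2 g3)) * uval (alpha g1 (g2 * g3)%g)
      & forall g h : G,
          eta g \o eta h =1 inner (alpha g h) \o eta (g * h)%g]].

Record gammaType := MkGamma { gamma_pair :> cpair; gammaP : Gamma gamma_pair }.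

Definition autL phi lam : G -> units R := fun g => unit_map phi (lam g).
Definition grpL sigma lam : G -> units R := fun g => lam ((sigma^-1)%g g).

Definition aut_pair phi (p : cpair) : cpair :=
  (fun g1 g2 => unit_map phi (p.1 g1 g2), fun g => (phi * p.2 g * phi^-1)%g).

Definition grp_pair sigma (p : cpair) : cpair :=
  (fun g1 g2 => p.1 ((sigma^-1)%g g1) ((sigma^-1)%g g2),
   fun g => p.2 ((sigma^-1)%g g)).

Definition lam_pair lam (p : cpair) : cpair :=
  (fun g1 g2 => (lam g1 * unit_map (p.2 g1) (lam g2) * p.1 g1 g2
                 * (lam (g1 * g2))^-1)%g,
   fun g => (inner (lam g) * p.2 g)%g).

(* [KElt lam phi sigma] is the element lam.phi.sigma of K. *)
Record K := KElt { klam : G -> units R; kaut : algAut R; kgrp : grpAut G }.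

HB.instance Definition _ := gen_eqMixin K.
HB.instance Definition _ := gen_choiceMixin K.

Definition K_one := KElt (fun=> 1%g) 1%g 1%g.

(* lam.phi.sigma.lam'.phi'.sigma'
   = (lam * phi(sigma(lam'))).(phi * phi').(sigma * sigma') *)
Definition K_mul (k l : K) :=
  KElt (fun g => klam k g * autL (kaut k) (grpL (kgrp k) (klam l)) g)%g
       (kaut k * kaut l)%g (kgrp k * kgrp l)%g.

Definition K_inv (k : K) :=
  KElt (autL (kaut k)^-1%g (grpL (kgrp k)^-1%g (fun g => (klam k g)^-1%g)))
       (kaut k)^-1%g (kgrp k)^-1%g.

Lemma KEltP (k l : K) :
  klam k =1 klam l -> kaut k = kaut l -> kgrp k = kgrp l -> k = l.
Proof. by case: k l => [? ? ?] [? ? ?] /= /funext -> -> ->. Qed.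

Fact K_mulA : associative K_mul.
Proof.
move=> k l m; apply: KEltP => [g||] /=; rewrite ?mulgA //.
apply: units_inj; rewrite !uvalM /= rmorphM mulrA; congr (_ * _).
Qed.
Fact K_mul1 : left_id K_one K_mul.
Proof.
move=> k; apply: KEltP => [g||] /=; rewrite ?mul1g //.
by apply: units_inj.
Qed.
Fact K_1mul : right_id K_one K_mul.
Proof.
move=> k; apply: KEltP => [g||] /=; rewrite ?mulg1 //.
by apply: units_inj; rewrite uvalM /= rmorph1 mulr1.
Qed.
Fact K_mulV : left_inverse K_one K_inv K_mul.
Proof.
move=> k; apply: KEltP => [g||] /=; rewrite ?mulVg //.
apply: units_inj; rewrite uvalM /=.
set x := klam _ _; have <- : aut_inv (kaut k) 1 = 1.
  by apply: (can_inj (aut_funK (kaut k))); rewrite aut_invK rmorph1.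
by rewrite -(rmorphM ((kaut k)^-1)%g) mulVu.
Qed.
Fact K_Vmul : right_inverse K_one K_inv K_mul.
Proof.
move=> k; apply: KEltP => [g||] /=; rewrite ?mulgV //.
apply: units_inj; rewrite uvalM /= aut_invK.
have -> : (kgrp k)^-1%g^-1%g ((kgrp k)^-1%g g) = g by exact: gaut_invK.
by rewrite muluV.
Qed.

HB.instance Definition _ := isGroup.Build K
  K_mulA K_mul1 K_1mul K_mulV K_Vmul.

Definition Kact (k : K) (p : cpair) : cpair :=
  lam_pair (klam k) (aut_pair (kaut k) (grp_pair (kgrp k) p)).

Definition K_of_lam lam : K := KElt lam 1%g 1%g.
Definition K_of_aut phi : K := KElt (fun=> 1%g) phi 1%g.
Definition K_of_grp sigma : K := KElt (fun=> 1%g) 1%g sigma.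

Lemma KEltE lam phi sigma :
  KElt lam phi sigma = (K_of_lam lam * K_of_aut phi * K_of_grp sigma)%g.
Proof.
apply: KEltP => [g||] /=; rewrite ?mul1g ?mulg1 //.
by apply: units_inj; rewrite !uvalM /= rmorph1 !mulr1.
Qed.

Lemma K_aut_lam phi lam :
  (K_of_aut phi * K_of_lam lam = K_of_lam (autL phi lam) * K_of_aut phi)%g.
Proof.
apply: KEltP => [g||] /=; rewrite ?mul1g ?mulg1 //.
by apply: units_inj; rewrite uvalM /= mulr1.
Qed.

Lemma K_grp_lam sigma lam :
  (K_of_grp sigma * K_of_lam lam = K_of_lam (grpL sigma lam) * K_of_grp sigma)%g.
Proof.
apply: KEltP => [g||] /=; rewrite ?mul1g ?mulg1 //.
by apply: units_inj; rewrite uvalM /= mulr1.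
Qed.

Lemma K_aut_grp phi sigma :
  (K_of_aut phi * K_of_grp sigma = K_of_grp sigma * K_of_aut phi)%g.
Proof.
apply: KEltP => [g||] /=; rewrite ?mul1g ?mulg1 //.
by apply: units_inj; rewrite /= rmorph1.
Qed.

Definition K_L : set K := [set k | kaut k = 1%g /\ kgrp k = 1%g].
Definition K_LA : set K := [set k | kgrp k = 1%g].
Definition K_LG : set K := [set k | kaut k = 1%g].

Definition same_orbit (H : set K) (p q : cpair) :=
  exists2 k, H k & Kact k p = q.

End Gamma.

Arguments Out {F} R G _ : rename.
Arguments Gamma {F} R G _ : rename.
Arguments K_L {F} R G _ : rename.
Arguments K_LA {F} R G _ : rename.
Arguments K_LG {F} R G _ : rename.

Definition is_group_action_on (H : groupType) (T : Type) (S : set T)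
    (act : H -> T -> T) :=
  [/\ forall k x, S x -> S (act k x),
      forall x, S x -> act 1%g x = x
    & forall k l x, S x -> act (k * l)%g x = act k (act l x)].

(* The carrier of the crossed product is the type {malg R[G]} of finitely
   supported functions G -> R, i.e. the free left R-module on G: an element x
   has coefficients x@_g, and << r *g g >> is r u_g. *)
Section CrossedProduct.
Variables (F : pzRingType) (R : pzAlgType F) (G : groupType).

Definition crossed (p : gammaType R G) : Type := {malg R[G]}.

Variable p : gammaType R G.
Local Notation A := (crossed p).
Local Notation alpha := (p : cpair R G).1.
Local Notation eta := (p : cpair R G).2.

HB.instance Definition _ := GRing.Zmodule.on A.

Definition cmul (x y : A) : A :=
  \sum_(g <- msupp x) \sum_(h <- msupp y)
    << x@_g * eta g y@_h * uval (alpha g h) *g (g * h)%g >>.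

Definition cone : A := << uval (alpha 1 1)^-1%g *g 1%g >>.

Definition cscale (a : F) (x : A) : A :=
  \sum_(g <- msupp x) << ascale a x@_g *g g >>.

Lemma cmulw (d e : {fset G}) (x y : A) :
  (msupp x `<=` d)%fset -> (msupp y `<=` e)%fset ->
  cmul x y = \sum_(g <- d) \sum_(h <- e)
    << x@_g * eta g y@_h * uval (alpha g h) *g (g * h)%g >>.
Proof.
move=> xd ye; rewrite /cmul (big_fset_incl _ xd) /=; last first.
  move=> g _ /mcoeff_outdom xg; rewrite big1 // => h _.
  by rewrite xg !mul0r monalgU0.
apply: eq_bigr => g _; apply: big_fset_incl => // h _ /mcoeff_outdom ->.
by rewrite raddf0 mulr0 mul0r monalgU0.
Qed.

Lemma cmulUU (r s : R) (g h : G) :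
  cmul << r *g g >> << s *g h >>
  = << r * eta g s * uval (alpha g h) *g (g * h)%g >>.
Proof. by rewrite (cmulw msuppU_le msuppU_le) !big_seq_fset1 !mcoeffUU. Qed.

Fact cmulDl : left_distributive cmul +%R.
Proof.
move=> x y z; pose d := (msupp x `|` msupp y)%fset.
rewrite !(@cmulw d (msupp z)) ?fsubset_refl ?fsubsetUl ?fsubsetUr ?msuppD_le //.
rewrite -big_split; apply: eq_bigr => g _.
rewrite -big_split; apply: eq_bigr => h _ /=.
by rewrite mcoeffD !mulrDl monalgUD.
Qed.

Fact cmulDr : right_distributive cmul +%R.
Proof.
move=> z x y; pose d := (msupp x `|` msupp y)%fset.
rewrite !(@cmulw (msupp z) d) ?fsubset_refl ?fsubsetUl ?fsubsetUr ?msuppD_le //.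
rewrite -big_split; apply: eq_bigr => g _.
rewrite -big_split; apply: eq_bigr => h _ /=.
by rewrite mcoeffD raddfD mulrDr mulrDl monalgUD.
Qed.

Fact cmul0l (x : A) : cmul 0 x = 0.
Proof. by rewrite /cmul msupp0 big_seq_fset0. Qed.
Fact cmul0r (x : A) : cmul x 0 = 0.
Proof. by rewrite /cmul msupp0 big1 // => g _; rewrite big_seq_fset0. Qed.

Lemma crossed_ind (P : A -> Prop) :
  P 0 -> (forall x y, P x -> P y -> P (x + y)) ->
  (forall (r : R) (g : G), P << r *g g >>) -> forall x, P x.
Proof. by move=> P0 PD PU x; rewrite (monalgE x); apply: big_ind. Qed.

Fact alpha_cocycle (g1 g2 g3 : G) :
  uval (alpha g1 g2) * uval (alpha (g1 * g2)%g g3)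
  = eta g1 (uval (alpha g2 g3)) * uval (alpha g1 (g2 * g3)%g).
Proof. by case: p => -[al et] [/= _ + _]; apply. Qed.

Fact eta_alpha (g h : G) (r : R) :
  eta g (eta h r) * uval (alpha g h) = uval (alpha g h) * eta (g * h)%g r.
Proof.
case: p => -[al et] [/= _ _ /(_ g h r)] /= ->.
by rewrite /inner_fun -!mulrA mulVu mulr1.
Qed.

Fact eta1 (r : R) :
  eta 1%g r = uval (alpha 1 1)%g * r * uval (alpha 1 1)^-1%g.
Proof.
have /(congr1 (fun x => x * uval (alpha 1 1)^-1%g)) :=
  eta_alpha 1%g 1%g (aut_inv (eta 1%g) r).
by rewrite mulg1 -!mulrA muluV mulr1 !aut_invK.
Qed.

Fact alpha1l (g : G) : uval (alpha 1 g)%g = uval (alpha 1 1)%g.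
Proof.
have := alpha_cocycle 1%g 1%g g; rewrite !mul1g => e.
have {}e : uval (alpha 1 1)%g = eta 1%g (uval (alpha 1 g)%g).
  have := congr1 (fun x => x * uval (alpha 1 g)^-1%g) e.
  by rewrite -!mulrA muluV !mulr1.
move: e; rewrite eta1.
move/(congr1 (fun x => uval (alpha 1 1)^-1%g * x * uval (alpha 1 1)%g)).
by rewrite -!mulrA mulVu mulr1 mulrA mulVu mul1r !mulrA mulVu mul1r.
Qed.

Fact alpha1r (g : G) : uval (alpha g 1)%g = eta g (uval (alpha 1 1)%g).
Proof.
have := alpha_cocycle g 1%g 1%g; rewrite !mulg1 => e.
have := congr1 (fun x => x * uval (alpha g 1)^-1%g) e.
by rewrite -!mulrA muluV !mulr1.
Qed.

Fact cmulA : associative cmul.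
Proof.
move=> x y z.
elim/crossed_ind: x => [|x x' IHx IHx'|r g1];
  first by rewrite !cmul0l.
  by rewrite !cmulDl IHx IHx'.
elim/crossed_ind: y => [|y y' IHy IHy'|s g2];
  first by rewrite cmul0r !cmul0l cmul0r.
  by rewrite cmulDl !cmulDr IHy IHy' cmulDl.
elim/crossed_ind: z => [|z z' IHz IHz'|t g3];
  first by rewrite !cmul0r.
  by rewrite !cmulDr IHz IHz'.
rewrite !cmulUU mulgA; congr << _ *g _ >>.
rewrite !rmorphM /= -!mulrA; congr (_ * (_ * _)).
by rewrite -alpha_cocycle !mulrA eta_alpha.
Qed.

Fact cmul1x : left_id cone cmul.
Proof.
move=> x; elim/crossed_ind: x => [|x y IHx IHy|r g]; first by rewrite cmul0r.
  by rewrite cmulDr IHx IHy.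
rewrite cmulUU mul1g eta1 alpha1l -!mulrA mulVu mulr1 mulrA mulVu mul1r //.
Qed.

Fact cmulx1 : right_id cone cmul.
Proof.
move=> x; elim/crossed_ind: x => [|x y IHx IHy|r g]; first by rewrite cmul0l.
  by rewrite cmulDl IHx IHy.
by rewrite cmulUU mulg1 alpha1r -mulrA -rmorphM /= mulVu rmorph1 mulr1.
Qed.

HB.instance Definition _ := GRing.Zmodule_isPzRing.Build A
  cmulA cmul1x cmulx1 cmulDl cmulDr.

Lemma cscaleE a (x : A) g : (cscale a x)@_g = ascale a x@_g.
Proof.
rewrite raddf_sum /=; have [gx|gx] := boolP (g \in msupp x).
  rewrite (big_fsetD1 g) //= mcoeffUU big1_fset ?addr0 // => h.
  by rewrite in_fsetD1 mcoeffU; case: eqP.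
rewrite (mcoeff_outdom gx) ascale0 big1_fset // => h hx _.
by rewrite mcoeffU; case: eqP hx gx => // -> ->.
Qed.

Lemma cscaleU a (r : R) g :
  cscale a << r *g g >> = << ascale a r *g g >>.
Proof.
apply/malgP => h; rewrite cscaleE !mcoeffU.
by case: eqP => _; rewrite ?mulr1n ?mulr0n ?ascale0.
Qed.

Fact cscaleA (a b : F) (x : A) : cscale a (cscale b x) = cscale (a * b) x.
Proof. by apply/malgP => g; rewrite !cscaleE ascaleA. Qed.
Fact cscale1 (x : A) : cscale 1 x = x.
Proof. by apply/malgP => g; rewrite cscaleE ascale1. Qed.
Fact cscaleDr (a : F) (x y : A) : cscale a (x + y) = cscale a x + cscale a y.
Proof.
by apply/malgP => g; rewrite cscaleE !mcoeffD !cscaleE ascaleDr.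
Qed.
Fact cscaleDl (a b : F) (x : A) : cscale (a + b) x = cscale a x + cscale b x.
Proof. by apply/malgP => g; rewrite mcoeffD !cscaleE ascaleDl. Qed.
Fact cscale0 (a : F) : cscale a 0 = 0.
Proof. by rewrite /cscale msupp0 big_seq_fset0. Qed.
Fact cscaleAl (a : F) (x y : A) : cscale a (x * y) = cscale a x * y.
Proof.
elim/crossed_ind: x => [|x x' IHx IHx'|r g];
  first by rewrite cscale0 !mul0r cscale0.
  by rewrite cscaleDr !mulrDl cscaleDr IHx IHx'.
elim/crossed_ind: y => [|y y' IHy IHy'|s h];
  first by rewrite !mulr0 cscale0.
  by rewrite !mulrDr cscaleDr IHy IHy'.
by rewrite /GRing.mul /= !(cscaleU, cmulUU) !ascaleAl.
Qed.
Fact cscaleAr (a : F) (x y : A) : cscale a (x * y) = x * cscale a y.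
Proof.
elim/crossed_ind: x => [|x x' IHx IHx'|r g];
  first by rewrite !mul0r cscale0.
  by rewrite !mulrDl cscaleDr IHx IHx'.
elim/crossed_ind: y => [|y y' IHy IHy'|s h];
  first by rewrite cscale0 !mulr0 cscale0.
  by rewrite cscaleDr !mulrDr cscaleDr IHy IHy'.
by rewrite /GRing.mul /= !(cscaleU, cmulUU) aut_scale -ascaleAr -ascaleAl.
Qed.

HB.instance Definition _ := hasAlgScale.Build F A
  cscaleA cscale1 cscaleDr cscaleDl cscaleAl cscaleAr.

Definition lscale (r : R) (x : A) : A :=
  \sum_(g <- msupp x) << r * x@_g *g g >>.

Definition embed (r : R) : A := lscale r 1.

Definition hcomp (g : G) : set A := range (fun r : R => << r *g g >> : A).

End CrossedProduct.

Arguments lscale {F R G} p r x.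
Arguments embed {F R G} p r.
Arguments hcomp {F R G} p g.

Section Equivalences.
Variables (F : pzRingType) (R : pzAlgType F) (G : groupType).
Variables p q : gammaType R G.
Implicit Types (psi : crossed p -> crossed q) (sigma : grpAut G).

Definition is_graded_iso psi :=
  is_alg_iso psi /\ forall g, (psi @` hcomp p g)%classic = hcomp q g.

Definition is_graded_equiv psi :=
  is_alg_iso psi /\
  exists sigma, forall g, (psi @` hcomp p g)%classic = hcomp q (sigma g).

Definition fixes_R psi := forall r : R, psi (embed p r) = embed q r.

Definition graded_isomorphic := exists psi, is_graded_iso psi.
Definition graded_equivalent := exists psi, is_graded_equiv psi.
Definition clifford_equivalent :=
  exists psi, is_graded_iso psi /\ fixes_R psi.
Definition graded_isometric :=
  exists psi, is_graded_equiv psi /\ fixes_R psi.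

End Equivalences.

(* Main.v *)
(** For k = lam.phi.sigma with k.(alpha, eta) = (alpha', eta'), the map
    r u_g |-> phi(r) lam(sigma g)^-1 u'_{sigma g} is a graded equivalence; its
    inverse is the map attached to k^-1.  Conversely, a graded equivalence psi
    along sigma preserves the identity component, hence restricts to an
    automorphism phi of R, and psi(u_g) = c_g u'_{sigma g} with c_g a unit;
    then lam(g) = c_{sigma^-1 g}^-1 works.  The four equivalence relations
    correspond to sigma = 1 and/or phi = 1. *)
Require Import Defs.
From mathcomp Require Import all_boot all_algebra boolp classical_sets.
From mathcomp Require Import finmap monalg.

Set Implicit Arguments.
Unset Strict Implicit.
Unset Printing Implicit Defensive.

Import GRing.Theory.

(** * Units under algebra automorphisms, and inner automorphisms *)

Section UnitMaps.
Variables (F : pzRingType) (R : pzAlgType F).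
Implicit Types (f g : algAut R) (u v w : units R).
Local Open Scope group_scope.

Lemma unit_mapM f : {morph unit_map f : u v / u * v}.
Proof. by move=> u v; apply: units_inj; rewrite /= rmorphM. Qed.

Lemma unit_map1 f : unit_map f 1 = 1.
Proof. by apply: units_inj; rewrite /= rmorph1. Qed.

Lemma unit_mapV f : {morph unit_map f : u / u^-1}.
Proof. by move=> u; apply: units_inj. Qed.

Lemma unit_map_mul f g u : unit_map (f * g) u = unit_map f (unit_map g u).
Proof. exact: units_inj. Qed.

Lemma unit_mapK f : cancel (unit_map f) (unit_map f^-1).
Proof. by move=> u; apply: units_inj; rewrite /= aut_funK. Qed.

Lemma unit_map_id u : unit_map (1 : algAut R) u = u.
Proof. exact: units_inj. Qed.

Lemma unit_map_inner u v : unit_map (inner u) v = u * v * u^-1.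
Proof. exact: units_inj. Qed.

Lemma innerM u v : inner (u * v) = inner u * inner v.
Proof. by apply: algAutP => x; rewrite /= /inner_fun /= !mulrA. Qed.

Lemma inner1 : inner (1 : units R) = 1.
Proof. by apply: algAutP => x; rewrite /= /inner_fun /= mul1r mulr1. Qed.

Lemma innerV u : inner u^-1 = (inner u)^-1.
Proof. by apply/esym/mulg1_eq; rewrite -innerM mulgV inner1. Qed.

Lemma aut_inner f u : f * inner u = inner (unit_map f u) * f.
Proof. by apply: algAutP => x; rewrite /= /inner_fun /= !rmorphM. Qed.

End UnitMaps.

(** * The action of K on Gamma *)

Section GammaAction.
Variables (F : pzRingType) (R : pzAlgType F) (G : groupType).
Implicit Types (al : G -> G -> units R) (eta : G -> algAut R).
Implicit Types (lam : G -> units R) (phi : algAut R) (sigma : grpAut G).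
Implicit Types (p q : cpair R G).
Local Open Scope group_scope.

Lemma gaut1 sigma : sigma 1 = 1.
Proof. by apply: (mulgI (sigma 1)); rewrite -gaut_morph !mulg1. Qed.

(* The outer-action condition in [Gamma] is a consequence of
   [eta g * eta h = inner (alpha g h) * eta (g * h)]. *)
Lemma GammaE p :
  Gamma R G p <->
  (forall g h k, p.1 g h * p.1 (g * h) k
                 = unit_map (p.2 g) (p.1 h k) * p.1 g (h * k)) /\
  (forall g h, p.2 g * p.2 h = inner (p.1 g h) * p.2 (g * h)).
Proof.
case: p => al eta; split=> [[_ cocy act]|[cocy act]]; split=> /=.
- by move=> g h k; apply: units_inj; apply: cocy.
- by move=> g h; apply: algAutP => x; apply: act.
- by move=> g h /=; exists (al g h) => //=; rewrite act mulgK.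
- by move=> g h k; apply: (congr1 (@uval R) (cocy g h k)).
- by move=> g h x; apply: (congr1 (fun f : algAut R => f x) (act g h)).
Qed.


Lemma lam_pair_Gamma lam p : Gamma R G p -> Gamma R G (lam_pair lam p).
Proof.
case/GammaE=> cocy act; apply/GammaE; split=> [g h k|g h] /=; last first.
  rewrite !innerM innerV -!mulgA mulKg -act.
  by rewrite (mulgA (p.2 g)) aut_inner -!mulgA.
rewrite unit_map_mul unit_map_inner -!mulgA !mulKg !unit_mapM !unit_mapV.
rewrite -!mulgA; congr (_ * (_ * _)).
(* The composition law evaluated at [lam k] expresses eta_g(eta_h(lam k)) as a conjugate of
   eta_gh(lam k) by alpha(g, h); what then remains is the cocycle identity of [p]. *)
have /(congr1 (fun f => unit_map f (lam k))) := act g h.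
rewrite !unit_map_mul unit_map_inner => ->.
by rewrite -!mulgA !mulKg (mulgA (unit_map _ (p.1 h k))) -cocy -!mulgA mulKg.
Qed.

Lemma aut_pair_Gamma phi p : Gamma R G p -> Gamma R G (aut_pair phi p).
Proof.
case/GammaE=> cocy act; apply/GammaE; split=> [g h k|g h] /=.
  by rewrite -unit_mapM cocy unit_mapM !unit_map_mul unit_mapK.
by rewrite !mulgA mulgVK -(mulgA phi) act !mulgA aut_inner.
Qed.

Lemma grp_pair_Gamma sigma p : Gamma R G p -> Gamma R G (grp_pair sigma p).
Proof.
case/GammaE=> cocy act; apply/GammaE; split=> [g h k|g h] /=.
  by rewrite !gaut_inv_morph cocy.
by rewrite gaut_inv_morph act.
Qed.

Lemma Kact_Gamma (k : K R G) p : Gamma R G p -> Gamma R G (Kact k p).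
Proof. by move=> ?; apply/lam_pair_Gamma/aut_pair_Gamma/grp_pair_Gamma. Qed.

Lemma cpairP p q :
  (forall g h, p.1 g h = q.1 g h) -> (forall g, p.2 g = q.2 g) -> p = q.
Proof.
case: p q => [al eta] [al' eta'] /= eal eeta; congr pair.
  by apply/funext => g; apply/funext => h.
exact/funext.
Qed.

Lemma Kact1 p : Kact (1 : K R G) p = p.
Proof.
apply: cpairP => [g h|g] /=; last by rewrite inner1 invg1 mulg1 !mul1g.
by rewrite unit_map1 unit_map_id !mul1g invg1 mulg1.
Qed.

(** Moving the lam-part of [l] past the automorphisms of [k] replaces it by its image under them,
    which is the twist in the product of K; the conjugations by [klam k] cancel. *)
Lemma KactM (k l : K R G) p : Kact (k * l) p = Kact k (Kact l p).
Proof.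
apply: cpairP => [g h|g] /=; rewrite /autL /grpL.
  rewrite !gaut_morph !invgM !(unit_map_mul, unit_mapM, unit_mapV).
  rewrite unit_map_inner !(unit_mapM, unit_mapV) unit_mapK -!mulgA.
  by rewrite !mulKg.
rewrite innerM !invgM !mulgA; congr (_ * _ * _ * _ * _).
by rewrite -!mulgA aut_inner.
Qed.

End GammaAction.

Local Open Scope ring_scope.

(** * Coefficients of reindexed finite sums *)

Section Coefficients.
Variables (R : pzRingType) (G : choiceType).

(** Serves both [lscale] and [twist], which are sums over the support of [x]. As [f] vanishes off
    that support, one formula covers all [h]. *)
Lemma mcoeff_reindex_sum (x : {malg R[G]}) (f : G -> R) (s t : G -> G) h :
  cancel s t -> cancel t s -> (forall g, x@_g = 0 -> f g = 0) ->
  (\sum_(g <- msupp x) << f g *g s g >>)@_h = f (t h).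
Proof.
move=> sK tK f0; rewrite raddf_sum /=.
have [hx|hx] := boolP (t h \in msupp x).
  rewrite (big_fsetD1 (t h)) //= tK mcoeffUU big1_fset ?addr0 // => g.
  rewrite in_fsetD1 mcoeffU => /andP[/eqP gth _] _.
  by case: eqP => // /(canRL sK).
rewrite f0 ?mcoeff_outdom // big1_fset // => g gx _.
by rewrite mcoeffU; case: eqP => // /(canRL sK) egh; rewrite -egh gx in hx.
Qed.

End Coefficients.

(** * Homogeneous elements and the embedding of R *)

Section CrossedBasics.
Variables (F : pzRingType) (R : pzAlgType F) (G : groupType).
Variable p : gammaType R G.
Local Notation A := (crossed p).
Local Notation alpha := (p : cpair R G).1.
Local Notation eta := (p : cpair R G).2.
Implicit Types (r s : R) (g h : G) (u : units R).

Lemma mulVuK u : cancel ( *%R^~ (uvalV u)) ( *%R^~ (uval u)).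
Proof. by move=> r; rewrite -mulrA uvalVK mulr1. Qed.

(** The monomial r u_g, typed so that [*] is the multiplication of the crossed product. *)
Definition hmon r g : A := << r *g g >>.

Lemma hmonM r s g h :
  hmon r g * hmon s h = hmon (r * eta g s * uval (alpha g h)) (g * h)%g.
Proof. exact: cmulUU. Qed.

Lemma hmonD r s g : hmon (r + s) g = hmon r g + hmon s g.
Proof. exact: monalgUD. Qed.

Lemma hmonZ a r g : ascale a (hmon r g) = hmon (ascale a r) g.
Proof. exact: cscaleU. Qed.

Lemma hmon1 : 1 = hmon (uval (alpha 1 1)^-1)%g 1%g.
Proof. by []. Qed.

Lemma hmon_inj g : injective (hmon^~ g).
Proof. by move=> r s /(congr1 (mcoeff g)); rewrite !mcoeffUU. Qed.

(** Cocycles are not normalized, so the unit is alpha(1,1)^-1 u_1 and the embedding carries this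
    factor. *)
Lemma embedE r : embed p r = hmon (r * uval (alpha 1 1)^-1%g) 1%g.
Proof.
apply/malgP => h; rewrite (@mcoeff_reindex_sum _ _ _ _ id id) // => [|g ->].
  by rewrite !mcoeffU; case: eqP; rewrite ?mulr1n ?mulr0n ?mulr0.
by rewrite mulr0.
Qed.

Lemma embed_inj : injective (embed p).
Proof.
move=> r s; rewrite !embedE => /hmon_inj.
move/(congr1 ( *%R^~ (uval (alpha 1 1)%g))).
by rewrite -!mulrA mulVu !mulr1.
Qed.

Lemma hmonE r : hmon r 1%g = embed p (r * uval (alpha 1 1)%g).
Proof. by rewrite embedE -mulrA muluV mulr1. Qed.

(** The correction factor cancels because eta_1 is conjugation by alpha(1,1) and alpha(1,g) =
    alpha(1,1). *)
Lemma embedMhmon r s g : embed p r * hmon s g = hmon (r * s) g.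
Proof.
rewrite embedE hmonM mul1g eta1 alpha1l -!mulrA mulVu mulr1.
by rewrite (mulrA (uval (_^-1)%g)) mulVu mul1r.
Qed.

(** With s = 1 this is u_g r = eta_g(r) u_g, from which eta can be read off inside the ring. *)
Lemma hmonMembed r s g : hmon s g * embed p r = hmon (s * eta g r) g.
Proof.
rewrite embedE hmonM mulg1 alpha1r -!mulrA -rmorphM /=.
by rewrite -mulrA mulVu mulr1.
Qed.

Lemma embed_morph : is_alg_morph (embed p).
Proof.
split=> [r s|a r||r s].
- by rewrite !embedE mulrDl hmonD.
- by rewrite !embedE hmonZ ascaleAl.
- by rewrite embedE mul1r.
- by rewrite (embedE s) embedMhmon embedE mulrA.
Qed.

End CrossedBasics.

(** * The graded map attached to an element of K *)

Section Twist.
Variables (F : pzRingType) (R : pzAlgType F) (G : groupType).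
Implicit Types (p q : gammaType R G) (k l : K R G).

(** As an additive map it makes sense for any [k], so composing and inverting reduce to computing in
    K; [Kact k p = q] enters with the ring multiplication. *)
Definition twist p q k (x : crossed p) : crossed q :=
  \sum_(g <- msupp x)
    hmon q (kaut k x@_g * uval (klam k (kgrp k g))^-1%g) (kgrp k g).

Lemma mcoeff_twist p q k x h :
  (twist q k x : crossed q)@_h
  = kaut k (x : crossed p)@_((kgrp k)^-1%g h) * uval (klam k h)^-1%g.
Proof.
rewrite (mcoeff_reindex_sum _ (gaut_funK _) (gaut_invK _)) ?gaut_invK //.
by move=> g ->; rewrite raddf0 mul0r.
Qed.

Lemma twist_hmon p q k r g :
  twist q k (hmon p r g)
  = hmon q (kaut k r * uval (klam k (kgrp k g))^-1%g) (kgrp k g).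
Proof.
apply/malgP => h; rewrite mcoeff_twist !mcoeffU.
rewrite (can2_eq (gaut_funK _) (gaut_invK _)).
by case: eqP => [->|_]; rewrite ?gaut_invK ?mulr1n // raddf0 mul0r.
Qed.

Lemma twistD p q k : {morph @twist p q k : x y / x + y}.
Proof.
move=> x y; apply/malgP=> h.
by rewrite mcoeffD !mcoeff_twist mcoeffD raddfD mulrDl.
Qed.

Lemma twist0 p q k : @twist p q k 0 = 0.
Proof.
by have := @twistD p q k 0 0; rewrite addr0 -{1}[twist q k 0]addr0 => /addrI.
Qed.

Lemma twistZ p q k a : {morph @twist p q k : x / ascale a x}.
Proof.
move=> x; apply/malgP=> h; rewrite cscaleE !mcoeff_twist cscaleE.
by rewrite aut_scale ascaleAl.
Qed.

Lemma twist1 p : @twist p p 1%g =1 id.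
Proof.
by move=> x; apply/malgP => h; rewrite mcoeff_twist /= mulr1.
Qed.

(** Inverting the lam-part of [k * l] reverses its two factors, which is the order in which the
    successive twists multiply on the right. *)
Lemma twistM p q q' k l (x : crossed p) :
  twist q' (k * l)%g x = twist q' k (twist q l x).
Proof.
apply/malgP => h; rewrite !mcoeff_twist !invgM rmorphM /= mulrA.
by rewrite /autL.
Qed.

Lemma twistK p q k : cancel (@twist p q k) (@twist q p k^-1%g).
Proof. by move=> x; rewrite -twistM mulVg twist1. Qed.

Lemma twistVK p q k : cancel (@twist q p k^-1%g) (@twist p q k).
Proof. by move=> x; rewrite -twistM mulgV twist1. Qed.

Lemma twist_hcomp p q k g :
  (@twist p q k @` hcomp p g)%classic = hcomp q (kgrp k g).
Proof.
apply/seteqP; split=> [_ [_ [r _ <-] <-]|_ [s _ <-]].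
  by rewrite twist_hmon; eexists.
(* The coefficient solves phi(r) lam(sigma g)^-1 = s for r. *)
exists (hmon p (aut_inv (kaut k) (s * uval (klam k (kgrp k g)))) g).
  by eexists.
by rewrite twist_hmon aut_invK -mulrA muluV mulr1.
Qed.

Lemma twist_mul p q k : Kact k p = q ->
  {morph @twist p q k : x y / x * y}.
Proof.
move=> epq x y.
elim/crossed_ind: x => [|x x' IHx IHx'|r g]; first by rewrite !(mul0r, twist0).
  by rewrite !(mulrDl, twistD) IHx IHx'.
elim/crossed_ind: y => [|y y' IHy IHy'|s h]; first by rewrite !(mulr0, twist0).
  by rewrite !(mulrDr, twistD) IHy IHy'.
rewrite -[<< r *g g >>]/(hmon p r g) -[<< s *g h >>]/(hmon p s h).
rewrite hmonM !twist_hmon hmonM -epq gaut_morph; congr (hmon _ _ _) => /=.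
set f := kaut k; set u := klam k _; set v := klam k (kgrp k h).
have -> : aut_inv f (f s * uvalV v) = s * aut_inv f (uvalV v).
  by apply: (can_inj (aut_funK f)); rewrite rmorphM /= !aut_invK.
(* Up to conjugation by [u], [e] is the automorphism of [q] at sigma g. The factor e(v^-1) from the
   second monomial meets e(v) from the cocycle of [q]. *)
pose e := f \o (gamma_pair p).2 g \o aut_inv f.
have evV : e (uvalV v) * e (uval v) = 1.
  exact: uvalVK (unit_map (f * (gamma_pair p).2 g * f^-1)%g v).
rewrite {}/e /= in evV.
rewrite !gaut_funK /inner_fun !rmorphM !mulrA /= !mulVuK.
by rewrite -[X in _ = X * _ * _]mulrA evV mulr1.
Qed.

(** The map is multiplicative and onto: writing 1 as an image shows that the image of 1 fixes it
    from the left. *)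
Lemma twist_one p q k : Kact k p = q -> @twist p q k 1 = 1.
Proof.
move=> epq; rewrite -[LHS]mulr1 -[X in _ * X](@twistVK p q k 1).
by rewrite -twist_mul // mul1r twistVK.
Qed.

Lemma twist_embed p q k r : Kact k p = q ->
  twist q k (embed p r) = embed q (kaut k r).
Proof.
move=> epq; have := twist_one epq.
(* The coefficients at u_1 give phi(alpha(1,1)^-1) lam(1)^-1 = alpha'(1,1)^-1. *)
rewrite (hmon1 p) (hmon1 q) twist_hmon gaut1 => /hmon_inj e1.
by rewrite !embedE twist_hmon gaut1 rmorphM -mulrA e1.
Qed.

Lemma twist_alg_iso p q k : Kact k p = q -> is_alg_iso (@twist p q k).
Proof.
move=> epq; split; last first.
  by exists (twist p k^-1%g); [apply: twistK|apply: twistVK].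
by split; [apply: twistD|apply: twistZ|apply: twist_one|apply: twist_mul].
Qed.

End Twist.

(** * From a graded equivalence to an element of K *)

Section GradedEquivalence.
Variables (F : pzRingType) (R : pzAlgType F) (G : groupType).
Variables (p q : gammaType R G) (psi : crossed p -> crossed q).
Variable sigma : grpAut G.
Hypothesis psi_iso : is_alg_iso psi.
Hypothesis psi_graded :
  forall g, (psi @` hcomp p g)%classic = hcomp q (sigma g).

Lemma graded_img r g : exists s, psi (hmon p r g) = hmon q s (sigma g).
Proof.
have : hcomp q (sigma g) (psi (hmon p r g)).
  by rewrite -psi_graded; exists (hmon p r g) => //; exists r.
by case=> s _ <-; exists s.
Qed.

Lemma graded_preimg s g : exists r, psi (hmon p r g) = hmon q s (sigma g).
Proof.
have : hcomp q (sigma g) (hmon q s (sigma g)) by exists s.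
by rewrite -psi_graded => -[_ [r _ <-] e]; exists r.
Qed.

Lemma graded_restriction :
  exists phi : algAut R, forall r, psi (embed p r) = embed q (phi r).
Proof.
have [[psiD psiZ psi1 psiM] /bij_inj psi_inj] := psi_iso.
have [qD qZ q1 qM] := embed_morph q; have [pD pZ p1 pM] := embed_morph p.
(* [f] and [f'] are psi and its inverse read on the identity components; injectivity of the
   embeddings makes them mutually inverse and transfers the algebra laws. *)
have /choice[f fE] r : exists s, psi (embed p r) = embed q s.
  rewrite embedE; set r' := r * _; have [s ->] := graded_img r' 1%g.
  by rewrite gaut1 hmonE; eexists.
have /choice[f' f'E] s : exists r, psi (embed p r) = embed q s.
  have [r] := graded_preimg (s * uval ((q : cpair R G).1 1%g 1%g)^-1%g) 1%g.
  by rewrite gaut1 hmonE -embedE; eexists; eassumption.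
have fK : cancel f f'.
  by move=> r; apply/(@embed_inj _ _ _ p)/psi_inj; rewrite f'E fE.
have f'K : cancel f' f by move=> s; apply/(@embed_inj _ _ _ q); rewrite -fE f'E.
have f_morph : is_alg_morph f.
  split=> [r s|a r||r s]; apply/(@embed_inj _ _ _ q); rewrite -fE.
  - by rewrite pD psiD qD !fE.
  - by rewrite pZ psiZ qZ fE.
  - by rewrite p1 psi1 q1.
  - by rewrite pM psiM qM !fE.
by exists (AlgAut fK f'K f_morph).
Qed.

(** If psi(u_g) = c u'_{sigma g} and psi(r u_g) = u'_{sigma g}, then phi(r) is a left inverse of c.
    Rewriting r u_g as u_g eta_g^-1(r) yields a right inverse, so c is a unit. *)
Lemma graded_unit g :
  exists c : units R, psi (hmon p 1 g) = hmon q (uval c) (sigma g).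
Proof.
have [[psiD psiZ psi1 psiM] _] := psi_iso.
have [phi phiE] := graded_restriction.
have [c cE] := graded_img 1 g; have [r rE] := graded_preimg 1 g.
have rc : phi r * c = 1.
  apply: (@hmon_inj _ _ _ q (sigma g)).
  by rewrite -rE -embedMhmon -phiE -cE -psiM embedMhmon mulr1.
pose eta := (p : cpair R G).2; pose eta' := (q : cpair R G).2.
pose d := eta' (sigma g) (phi (aut_inv (eta g) r)).
have cd : c * d = 1.
  apply: (@hmon_inj _ _ _ q (sigma g)).
  by rewrite -rE -hmonMembed -phiE -cE -psiM hmonMembed mul1r aut_invK.
have rd : phi r = d by rewrite -[phi r]mulr1 -cd mulrA rc mul1r.
by rewrite -rd in cd; exists (Units rc cd).
Qed.

Lemma graded_Kact (phi : algAut R) :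
  (forall r, psi (embed p r) = embed q (phi r)) ->
  exists lam, Kact (KElt lam phi sigma) p = q.
Proof.
move=> phiE; have [[psiD psiZ psi1 psiM] _] := psi_iso.
have /choice[c cE] := graded_unit.
pose eta := (p : cpair R G).2; pose eta' := (q : cpair R G).2.
pose alpha := (p : cpair R G).1; pose alpha' := (q : cpair R G).1.
have psiE r g : psi (hmon p r g) = hmon q (phi r * uval (c g)) (sigma g).
  by rewrite -embedMhmon -phiE -cE -psiM embedMhmon mulr1.
(* Apply psi to u_g r = eta_g(r) u_g. *)
have etaE g : (phi * eta g * phi^-1 = inner (c g) * eta' (sigma g))%g.
  suff e : (phi * eta g = inner (c g) * eta' (sigma g) * phi)%g.
    by rewrite e mulgK.
  apply: algAutP => r /=; rewrite /inner_fun.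
  apply: (can_inj (mulVuK (c g)^-1%g)); rewrite /= mulVuK.
  apply: (@hmon_inj _ _ _ q (sigma g)).
  by rewrite -psiE -hmonMembed -cE -phiE -psiM hmonMembed mul1r.
(* Apply psi to u_g u_h = alpha(g,h) u_gh. *)
have alphaE g h :
    (c g * unit_map (eta' (sigma g)) (c h) * alpha' (sigma g) (sigma h)
     = unit_map phi (alpha g h) * c (g * h))%g.
  apply/units_inj/(@hmon_inj _ _ _ q (sigma (g * h)%g)).
  rewrite /= -psiE gaut_morph.
  by rewrite -hmonM -!cE -psiM hmonM mul1r rmorph1 mul1r.
exists (fun g => (c (gaut_inv sigma g))^-1)%g.
(* Arguments are written as sigma of their preimages; then [etaE] solved for eta' and [alphaE]
   solved for alpha' give the two components. *)
apply: cpairP => [g h|g]; rewrite -(gaut_invK sigma g); last first.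
  by rewrite /= gaut_funK etaE innerV mulKg.
rewrite -(gaut_invK sigma h) /= -gaut_morph !gaut_funK etaE.
move: (gaut_inv sigma g) (gaut_inv sigma h) => {}g {}h.
rewrite unit_map_mul unit_map_inner unit_mapV invgK -!mulgA -alphaE.
by rewrite -!mulgA !mulKg.
Qed.

End GradedEquivalence.

Theorem theoremA (F : fieldType) (R : pzAlgType F) (G : groupType) :
  is_group_action_on (Gamma R G) (@Kact F R G) /\
  forall p q : gammaType R G,
    [/\ clifford_equivalent p q <-> same_orbit (K_L R G) p q,
        graded_isomorphic p q <-> same_orbit (K_LA R G) p q,
        graded_isometric p q <-> same_orbit (K_LG R G) p q
      & graded_equivalent p q <-> same_orbit [set: K R G]%classic p q].
Proof.
split; first by split=> [k x|x _|k l x _];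
  [apply: Kact_Gamma|apply: Kact1|apply: KactM].
move=> p q; split; split.
- case=> psi [[psi_iso psi_gr] psi_R].
  (* A graded isomorphism is a graded equivalence along the identity of G, and fixing R means that
     its restriction to R is the identity. *)
  have [lam e] := @graded_Kact _ _ _ _ _ _ 1%g psi_iso psi_gr 1%g psi_R.
  by exists (KElt lam 1%g 1%g).
- case=> k [ek eg] epq; exists (twist q k); split.
    by split=> [|g]; rewrite ?twist_hcomp ?eg //; apply: twist_alg_iso.
  by move=> r; rewrite twist_embed // ek.
- case=> psi [psi_iso psi_gr].
  have [phi phiE] := @graded_restriction _ _ _ _ _ _ 1%g psi_iso psi_gr.
  have [lam e] := @graded_Kact _ _ _ _ _ _ 1%g psi_iso psi_gr phi phiE.
  by exists (KElt lam phi 1%g).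
- case=> k eg epq; exists (twist q k).
  by split=> [|g]; rewrite ?twist_hcomp ?eg //; apply: twist_alg_iso.
- case=> psi [[psi_iso [sigma psi_gr]] psi_R].
  have [lam e] := graded_Kact psi_iso psi_gr (phi := 1%g) psi_R.
  by exists (KElt lam 1%g sigma).
- case=> k ek epq; exists (twist q k); split.
    split; first exact: twist_alg_iso.
    by exists (kgrp k) => g; rewrite twist_hcomp.
  by move=> r; rewrite twist_embed // ek.
- case=> psi [psi_iso [sigma psi_gr]].
  have [phi phiE] := graded_restriction psi_iso psi_gr.
  have [lam e] := graded_Kact psi_iso psi_gr phiE.
  by exists (KElt lam phi sigma).
- case=> k _ epq; exists (twist q k).
  split; first exact: twist_alg_iso.
  by exists (kgrp k) => g; rewrite twist_hcomp.
Qed.
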